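(* There exist two dynamical systems $(X,T)$ and $(Y,S)$, a proximal factor map $\pi\colon(X,T)\to(Y,S)$ and a point $y\in Y$ which is multi-recurrent (in $(Y,S)$) but such that $\pi^{-1}(y)$ does not contain any multi-recurrent points (of $(X,T)$).
   Context: A (topological) dynamical system $(X,T)$ consists of a (nonempty) compact metric space $(X,\rho)$ and a continuous map $T\colon X\to X$. A factor map $\pi\colon(X,T)\to(Y,S)$ is a continuous surjection $\pi\colon X\to Y$ with $\pi\circ T=S\circ\pi$. A pair $(x_1,x_2)\in X^2$ is proximal if $\liminf_{n\to\infty}\rho(T^nx_1,T^nx_2)=0$. A factor map $\pi$ is proximal if every pair $(x_1,x_2)\in X^2$ with $\pi(x_1)=\pi(x_2)$ is proximal. A point $x\in X$ is multi-recurrent if for every $d\ge 1$ there exists a strictly increasing sequence $\{n_k\}_{k=1}^\infty$ of positive integers such that $T^{in_k}x\to x$ as $k\to\infty$ for each $i=1,2,\dots,d$. *)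

(* Defs.v *)
From HB Require Import structures.
From mathcomp Require Import all_boot all_order all_algebra.
From mathcomp Require Import all_classical all_reals all_analysis.

Set Implicit Arguments.
Unset Strict Implicit.
Unset Printing Implicit Defensive.

Import Order.TTheory GRing.Theory Num.Theory.
Import numFieldNormedType.Exports.

Local Open Scope classical_set_scope.
Local Open Scope ring_scope.

Definition dynamical_system (R : realType) (X : metricType R) (T : X -> X) :=
  [/\ [set: X] !=set0, compact [set: X] & continuous T].

Definition factor_map (R : realType) (X Y : metricType R)
    (T : X -> X) (S : Y -> Y) (pi : X -> Y) :=
  [/\ continuous pi, set_surj [set: X] [set: Y] pi & pi \o T =1 S \o pi].

(* The liminf is taken in the extended reals, where it always exists. *)
Definition proximal_pair (R : realType) (X : metricType R) (T : X -> X)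
    (x1 x2 : X) :=
  limn_einf (fun n => (mdist (iter n T x1) (iter n T x2))%:E) = 0%E.

Definition proximal_map (R : realType) (X Y : metricType R)
    (T : X -> X) (pi : X -> Y) :=
  forall x1 x2 : X, pi x1 = pi x2 -> proximal_pair T x1 x2.

Definition multi_recurrent (R : realType) (X : metricType R) (T : X -> X)
    (x : X) :=
  forall d : nat, (1 <= d)%N ->
    exists n : nat -> nat,
      [/\ increasing_seq n, forall k, (0 < n k)%N &
          forall i : nat, (1 <= i <= d)%N ->
            iter (i * n k)%N T x @[k --> \oo] --> x].

(* Main.v *)
Require Import Defs.
From HB Require Import structures.
From mathcomp Require Import all_boot all_order all_algebra.
From mathcomp Require Import all_classical all_reals all_analysis.
From mathcomp Require Import zify.

Set Implicit Arguments.
Unset Strict Implicit.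
Unset Printing Implicit Defensive.

Import Order.TTheory GRing.Theory Num.Theory.

Local Open Scope classical_set_scope.

(** The example is symbolic. Let [A] be the set of natural numbers whose binary
    digits at the positions [0, 1, 4, 9, ...] all vanish, and let [y] be its
    indicator sequence. Colour the elements [n] of [A] with the parity of the
    2-adic valuation of [n]; this gives a sequence over an alphabet with two
    colours and a blank. [X] is the orbit closure of the coloured sequence, [Y]
    is its image under forgetting the colours, both with the shift map.

    The point [y] is multi-recurrent: since arbitrarily long stretches of digits
    are unconstrained, shifting by [i] times a suitable power of [2], for all
    [i <= d] at once, does not change a long prefix ([sparse_add]).

    The factor map is proximal: [A] has gaps of any given length in every
    sufficiently long window ([sparse_gap]), this property passes to the orbit
    closure, and two points with the same image are both blank along the gaps.

    No point [x] over [y] is multi-recurrent, and already [d = 2] fails. If [A]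
    returns to itself along a long prefix at time [m], then [m] is divisible by a
    large power of [2] ([sparse_return]). Hence, away from the origin, [x] carries
    the original colours ([coloured_fiber]), and [n] and [2 * n] always have
    different colours; so [x] cannot show its letter at [0], which is a colour, at
    both times [n] and [2 * n]. *)

(** * Spaces of sequences with the first-difference metric *)

Definition agree (V : Type) (N : nat) (x y : nat -> V) :=
  forall j, (j < N)%N -> x j = y j.

Section FirstDifference.
Context (R : realType) (V : eqType).
Implicit Types (x y z : nat -> V) (n N : nat).
Local Open Scope ring_scope.

Definition fdist x y : R :=
  if pselect (exists n, x n != y n) is left h then (ex_minn h).+1%:R^-1 else 0.

Lemma fdist_le x y N : agree N x y -> fdist x y <= N.+1%:R^-1.
Proof.
move=> xy; rewrite /fdist; case: pselect => [h|_]; last by rewrite invr_ge0.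
case: ex_minnP => n /negP xyn _; rewrite lef_pV2 ?posrE// ler_nat ltnS leqNgt.
by apply/negP => /xy /eqP.
Qed.

Lemma le_fdist x y n : x n != y n -> n.+1%:R^-1 <= fdist x y.
Proof.
move=> xyn; rewrite /fdist; case: pselect => [h|[]]; last by exists n.
by case: ex_minnP => m _ /(_ _ xyn); rewrite lef_pV2 ?posrE// ler_nat ltnS.
Qed.

Lemma fdist_ge0 x y : 0 <= fdist x y.
Proof. by rewrite /fdist; case: pselect. Qed.

Lemma fdist_agree x y N : fdist x y < N.+1%:R^-1 -> agree N.+1 x y.
Proof.
move=> xyN j jN; apply/eqP/negPn/negP => /le_fdist.
rewrite leNgt => /negP; apply.
by apply: lt_le_trans xyN _; rewrite lef_pV2 ?posrE// ler_nat.
Qed.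

Lemma fdistxx x : fdist x x = 0.
Proof.
by rewrite /fdist; case: pselect => // h; case: ex_minnP => n; rewrite eqxx.
Qed.

Lemma fdist_eq0 x y : fdist x y = 0 -> x = y.
Proof.
move=> xy; apply/funext => n; apply/eqP/negPn/negP => /le_fdist.
by rewrite xy leNgt invr_gt0 ltr0Sn.
Qed.

Lemma fdist_sym x y : fdist x y = fdist y x.
Proof.
wlog le : x y / fdist y x <= fdist x y.
  by move=> H; have [/H|/ltW/H] := leP (fdist y x) (fdist x y).
apply/eqP; rewrite eq_le le andbT {1}/fdist.
case: pselect => [h|_]; last exact: fdist_ge0.
by case: ex_minnP => n + _; rewrite eq_sym; exact: le_fdist.
Qed.

(** The first index at which [x] and [z] differ is one at which [x] and [y] or
    [y] and [z] differ, so one of the two summands already suffices. *)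
Lemma fdist_triangle y x z : fdist x z <= fdist x y + fdist y z.
Proof.
rewrite {1}/fdist; case: pselect => [h|_]; last by rewrite addr_ge0 ?fdist_ge0.
case: ex_minnP => n xz _; have [xy|/le_fdist xy] := eqVneq (x n) (y n).
  by apply: ler_wpDl (fdist_ge0 _ _) (le_fdist _); rewrite -xy.
exact: ler_wpDr (fdist_ge0 _ _) xy.
Qed.

End FirstDifference.

(** [R] occurs in the type so that instances for metrics with values in [R] can
    be attached to it. *)
Definition seq_space (R : realType) (V : eqType) (K : set (nat -> V)) : Type :=
  {x : nat -> V | K x}.

Section SeqSpace.
Context (R : realType) (V : eqType) (K : set (nat -> V)).
Local Notation X := (seq_space R K).

HB.instance Definition _ := gen_eqMixin X.
HB.instance Definition _ := gen_choiceMixin X.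

Definition seq_dist (x y : X) : R := fdist R (sval x) (sval y).

Lemma seq_distxx x : seq_dist x x = 0%R.
Proof. exact: fdistxx. Qed.

Lemma seq_dist_eq0 x y : seq_dist x y = 0%R -> x = y.
Proof. by move/fdist_eq0; exact: eq_sig_hprop. Qed.

Lemma seq_dist_sym x y : seq_dist x y = seq_dist y x.
Proof. exact: fdist_sym. Qed.

Lemma seq_dist_triangle y x z :
  (seq_dist x z <= seq_dist x y + seq_dist y z)%R.
Proof. exact: fdist_triangle. Qed.

HB.instance Definition _ := @isMetric.Build R X seq_dist
  seq_distxx seq_dist_eq0 seq_dist_sym seq_dist_triangle.

Lemma nbhs_seq_spaceP (x : X) (P : set X) :
  nbhs x P <-> exists N, forall y : X, agree N (sval x) (sval y) -> P y.
Proof.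
split=> [/nbhs_ballP[e /= e0 xP]|[N xP]].
  have [N] := ltr_add_invr e0; rewrite add0r => Ne.
  exists N => y /(fdist_le R) xy; apply: xP.
  by rewrite ballEmdist; exact: le_lt_trans xy Ne.
apply/nbhs_ballP; exists N.+1%:R^-1%R; first by rewrite /= invr_gt0.
move=> y; rewrite ballEmdist => /fdist_agree xy.
by apply: xP => j jN; apply: xy; exact: ltnW.
Qed.

Lemma cvg_seq_spaceP (F : set_system X) {FF : Filter F} (x : X) :
  F --> x <-> forall N, F [set y | agree N (sval x) (sval y)].
Proof.
split=> [Fx N|FN P /nbhs_seq_spaceP[N xP]]; last exact: filterS xP (FN N).
by apply: Fx; apply/nbhs_seq_spaceP; exists N.
Qed.

Context (K_shift : forall x, K x -> K (fun j => x j.+1)).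

Definition shift (x : X) : X := exist _ _ (K_shift (proj2_sig x)).

Lemma sval_iter_shift n (x : X) j : sval (iter n shift x) j = sval x (n + j)%N.
Proof. by elim: n j => //= n IHn j; rewrite IHn addnS. Qed.

Lemma cvg_iter_shiftP (x : X) (e : nat -> nat) :
  iter (e k) shift x @[k --> \oo] --> x <->
  forall N, exists k0, forall k, (k0 <= k)%N ->
    agree N (sval x) (fun j => sval x (e k + j)%N).
Proof.
split=> [/(@cvg_seq_spaceP _ (fmap_filter _ _)) xe N|xe].
  have [k0 _ xk0] := xe N; exists k0 => k /xk0 xk j /xk ->.
  exact: sval_iter_shift.
apply/(@cvg_seq_spaceP (_ @ \oo) (fmap_filter _ _)) => N.
have [k0 xk0] := xe N; exists k0 => // k /xk0 xk j /xk ->.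
by rewrite sval_iter_shift.
Qed.

Lemma shift_continuous : continuous shift.
Proof.
move=> x.
apply/(@cvg_seq_spaceP (shift @ x) (fmap_filter _ (nbhs_filter x))) => N.
apply/nbhs_seq_spaceP; exists N.+1 => y xy j jN.
exact: xy.
Qed.

Lemma proximal_pair_shift (x y : X) :
  (forall N m, exists2 n, (m <= n)%N &
     agree N (fun j => sval x (n + j)%N) (fun j => sval y (n + j)%N)) ->
  proximal_pair shift x y.
Proof.
move=> xy; rewrite /proximal_pair limn_einf_lim.
rewrite (_ : einfs _ = cst 0%E) ?lim_cst//.
apply/funext => m; apply/eqP; rewrite eq_le; apply/andP; split.
  apply/lee_addgt0Pr => e e0; rewrite add0e.
  have [N] := ltr_add_invr e0; rewrite add0r => Ne.
  have [n mn xyn] := xy N m.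
  apply: (@le_trans _ _ (mdist (iter n shift x) (iter n shift y))%:E).
    by apply: ereal_inf_lbound; exists n.
  rewrite lee_fin; apply: le_trans (fdist_le R _) (ltW Ne) => j jN.
  by rewrite !sval_iter_shift; exact: xyn.
by apply: le_ereal_inf_tmp => _ [n _ <-]; rewrite lee_fin fdist_ge0.
Qed.

End SeqSpace.

(** * Orbit closures and their images under maps of letters *)

Section OrbitClosure.
Context (R : realType) (V : finType) (a : nat -> V).

Definition orbit_closure : set (nat -> V) :=
  [set x | forall N, exists n, agree N x (fun j => a (n + j)%N)].

Lemma orbit_closure_self : orbit_closure a.
Proof. by move=> N; exists 0%N. Qed.

Lemma orbit_closure_shift x :
  orbit_closure x -> orbit_closure (fun j => x j.+1).
Proof.
move=> ax N; have [n xn] := ax N.+1; exists n.+1 => j jN.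
by rewrite addSnnS; exact: xn.
Qed.

(** An ultrafilter chooses one cell of a partition into finitely many cells. *)
Lemma ultra_letter (T : Type) (F : set_system T) (f : T -> V) :
  UltraFilter F -> exists v, F [set t | f t = v].
Proof.
move=> FU; apply: contrapT => /forallNP noF.
have /filter_ex[t /(_ (f t))] : F [set t | forall v, f t <> v]; last by [].
apply: filter_forall => v.
by have [/noF|] := in_ultra_setVsetC [set t | f t = v] FU.
Qed.

Lemma ultra_agree (T : Type) (F : set_system T) (f : T -> nat -> V) :
  UltraFilter F -> exists z, forall N, F [set t | agree N z (f t)].
Proof.
move=> FU; have /choice[z Fz] : forall j, exists v, F [set t | f t j = v].
  by move=> j; exact: ultra_letter.
exists z => N.
have FN : F [set t | forall j : 'I_N, f t j = z j].
  by apply: (@filter_forall _ _ (fun j : 'I_N => [set t | f t j = z j])) => j.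
by apply: filterS FN => t /= tz j jN; rewrite (tz (Ordinal jN)).
Qed.

(** The sequence of letters chosen by an ultrafilter is its limit; it belongs to
    the orbit closure because it agrees on each prefix with some member. *)
Lemma orbit_closure_compact : compact [set: seq_space R orbit_closure].
Proof.
rewrite compact_ultra => F FU _.
have [z Fz] := ultra_agree (fun x : seq_space R orbit_closure => sval x) FU.
have az : orbit_closure z.
  move=> N; have /filter_ex[x zx] := Fz N.
  have [n xn] := proj2_sig x N; exists n => j jN; rewrite zx//; exact: xn.
by exists (exist _ z az); split => //; exact/cvg_seq_spaceP.
Qed.

End OrbitClosure.

Section LetterMap.
Context (R : realType) (V W : eqType) (g : V -> W) (K : set (nat -> V)).

Definition letter_image : set (nat -> W) := [set g \o x | x in K].

Lemma letter_image_shift : (forall x, K x -> K (fun j => x j.+1)) ->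
  forall y, letter_image y -> letter_image (fun j => y j.+1).
Proof. by move=> KS _ [x Kx <-]; exists (fun j => x j.+1); [exact: KS|]. Qed.

Definition letter_map (x : seq_space R K) : seq_space R letter_image :=
  exist _ (g \o sval x) (imageP (fun z => g \o z) (proj2_sig x)).

Lemma letter_map_continuous : continuous letter_map.
Proof.
move=> x; apply/(@cvg_seq_spaceP _ _ _ (letter_map @ x)
  (fmap_filter _ (nbhs_filter x))) => N.
by apply/nbhs_seq_spaceP; exists N => y xy j jN; rewrite /= xy.
Qed.

Lemma letter_map_surj : set_surj [set: seq_space R K] [set: _] letter_map.
Proof.
case=> y Ky _; case: (Ky) => x Kx gx.
by exists (exist _ x Kx) => //; exact: eq_sig_hprop.
Qed.

Lemma letter_image_compact :
  compact [set: seq_space R K] -> compact [set: seq_space R letter_image].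
Proof.
move=> Kco; rewrite (_ : setT = letter_map @` setT).
  apply: continuous_compact Kco; apply: continuous_subspaceT.
  exact: letter_map_continuous.
by apply/seteqP; split=> // y /letter_map_surj.
Qed.

End LetterMap.

(** * Numbers with vanishing binary digits at square positions *)

Section Sparse.
Local Open Scope nat_scope.

(** What matters about the squares is that the gaps between them are unbounded:
    the digits at the positions within a gap are free. *)
Definition sparse (n : nat) : bool := `[< forall k, ~~ odd (n %/ 2 ^ k ^ 2) >].

Lemma sparse0 : sparse 0.
Proof. by apply/asboolP => k; rewrite div0n. Qed.

Lemma exp2_sqS s : 2 ^ s.+1 ^ 2 = 2 ^ (2 * s) * 2 ^ (s ^ 2).+1.
Proof. by rewrite -expnD; congr (2 ^ _); lia. Qed.

Lemma ltn_expl_sq n : n < 2 ^ n ^ 2.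
Proof.
apply: leq_trans (ltn_expl n (isT : 1 < 2)) _.
by rewrite leq_exp2l// -mulnn; case: n => // n; exact: leq_pmulr.
Qed.

(** The digits of [i] land in the free zone strictly between the positions
    [s ^ 2] and [s.+1 ^ 2], so they do not affect membership; this is what makes
    the indicator of [sparse] multi-recurrent. *)
Lemma sparse_add s i j : i < 2 ^ (2 * s) -> j < 2 ^ (s ^ 2).+1 ->
  sparse (i * 2 ^ (s ^ 2).+1 + j) = sparse j.
Proof.
move=> i_lt j_lt; apply: asbool_equiv_eq.
suff bitE k :
    odd ((i * 2 ^ (s ^ 2).+1 + j) %/ 2 ^ k ^ 2) = odd (j %/ 2 ^ k ^ 2).
  by split=> + k => /(_ k); rewrite bitE.
have [k_le|s_lt] := leqP k s.
  have k2_le : k ^ 2 <= s ^ 2 by rewrite leq_exp2r.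
  rewrite -(subnK k2_le) -addSn expnD mulnA divnMDl ?expn_gt0// expnS.
  by rewrite oddD !oddM andbF.
have big_lt : i * 2 ^ (s ^ 2).+1 + j < 2 ^ k ^ 2.
  have : 2 ^ s.+1 ^ 2 <= 2 ^ k ^ 2 by rewrite leq_exp2l// leq_exp2r.
  apply: leq_trans; rewrite exp2_sqS.
  have := leq_mul i_lt (leqnn (2 ^ (s ^ 2).+1)); rewrite mulSn; lia.
by rewrite !divn_small//; apply: leq_ltn_trans big_lt; exact: leq_addl.
Qed.

(** The digit at position [s ^ 2] equals [1] on a block of length [2 ^ s ^ 2] in
    each period of length [2 * 2 ^ s ^ 2]; so long gaps occur syndetically. *)
Lemma sparse_gap s m : exists2 n,
  m <= n <= m + 3 * 2 ^ s ^ 2 & forall j, j < 2 ^ s ^ 2 -> ~~ sparse (n + j).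
Proof.
set b := 2 ^ s ^ 2; have b_gt0 : 0 < b by rewrite expn_gt0.
exists ((m %/ (2 * b)).+1 * (2 * b) + b) => [|j j_lt].
  have := divn_eq m (2 * b).
  have : m %% (2 * b) < 2 * b by rewrite ltn_mod; lia.
  by rewrite mulSn; lia.
apply/negP => /asboolP/(_ s); rewrite -/b.
set c := (_ %/ _).+1; have -> : c * (2 * b) + b + j = (c * 2).+1 * b + j by lia.
by rewrite divnMDl// (divn_small j_lt) addn0 oddS oddM andbF.
Qed.

(** Return times of [sparse] to itself are 2-adically small. If [2 ^ s ^ 2]
    divides the return time [n] but the digits of [n] in the free zone after
    position [s ^ 2] are not all zero, then some sparse [j] cancels these digits,
    and the carry of [n + j] lands in the forbidden position [s.+1 ^ 2]. *)
Lemma sparse_return s n :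
  (forall j, j < 2 ^ s ^ 2 -> sparse (n + j) = sparse j) -> 2 ^ s ^ 2 %| n.
Proof.
elim: s => [|s IHs] ret; first by rewrite dvd1n.
have n_sparse : sparse n by have := ret 0; rewrite addn0 sparse0 expn_gt0 => ->.
have [m nE] : exists m, n = m * 2 ^ (s ^ 2).+1.
  have /dvdnP[c nE] : 2 ^ s ^ 2 %| n.
    apply: IHs => j j_lt; apply: ret; apply: leq_trans j_lt _.
    by rewrite leq_exp2l// leq_exp2r.
  move/asboolP: n_sparse => /(_ s); rewrite nE mulnK ?expn_gt0// => c_even.
  by exists c./2; rewrite (expnS 2 (s ^ 2)) mulnA muln2 even_halfK.
set b := 2 ^ (s ^ 2).+1 in nE *; set c := 2 ^ (2 * s).
have b_gt0 : 0 < b by rewrite expn_gt0.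
have c_gt0 : 0 < c by rewrite expn_gt0.
have mE := divn_eq m c.
have r_lt : m %% c < c by rewrite ltn_mod.
have bcE : 2 ^ s.+1 ^ 2 = c * b by rewrite exp2_sqS.
have [r0|r_neq0] := eqVneq (m %% c) 0.
  by apply/dvdnP; exists (m %/ c); rewrite bcE nE {1}mE r0 addn0 mulnA.
(* The witness [j]: the negative of the free digits [m %% c] modulo [c]. *)
have j_lt : (c - m %% c) * b < 2 ^ s.+1 ^ 2.
  by rewrite bcE ltn_pmul2r//; lia.
have j_sparse : sparse ((c - m %% c) * b).
  by rewrite -[_ * b]addn0 sparse_add ?sparse0//; lia.
have := ret _ j_lt; rewrite j_sparse.
have -> : n + (c - m %% c) * b = (m %/ c).+1 * 2 ^ s.+1 ^ 2.
  rewrite bcE nE -mulnDl mulnA; congr (_ * _).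
  by rewrite {1}mE mulSn; lia.
move/asboolP => /(_ s.+1); rewrite mulnK ?expn_gt0//=.
move/asboolP: n_sparse => /(_ s.+1).
by rewrite nE bcE divnMr// => /negbTE ->.
Qed.

(** Adding a multiple of a high power of [p] does not disturb the valuation of
    a small positive number. *)
Lemma logn_addl_small p s n j : prime p ->
  p ^ s %| n -> 0 < j < p ^ s -> logn p (n + j) = logn p j.
Proof.
move=> p_pr n_dvd /andP[j_gt0 j_lt].
have nj_gt0 : 0 < n + j by rewrite addn_gt0 j_gt0 orbT.
have j_small : logn p j < s.
  rewrite -(ltn_exp2l _ _ (prime_gt1 p_pr)); apply: leq_ltn_trans j_lt.
  by apply: dvdn_leq => //; exact: pfactor_dvdnn.
have dvdE k : k <= s -> (p ^ k %| n + j) = (p ^ k %| j).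
  by move=> k_le; rewrite dvdn_addr// (dvdn_trans _ n_dvd)// dvdn_exp2l.
apply/eqP; rewrite eqn_leq leqNgt -!pfactor_dvdn// !dvdE//; last exact: ltnW.
by rewrite pfactor_dvdnn pfactor_dvdn// ltnn.
Qed.

(** The parity of the 2-adic valuation is chosen because it always differs
    between [n > 0] and [2 * n]. *)
Definition coloured (n : nat) : option bool :=
  if sparse n then Some (odd (logn 2 n)) else None.

End Sparse.

(** * The counterexample *)

Lemma coloured_isSome n : isSome (coloured n) = sparse n.
Proof. by rewrite /coloured; case: ifP. Qed.

(** A point [x] of the orbit closure lying over the indicator of [sparse] is seen
    near the origin as the colouring around some [m]; since [sparse] returns to
    itself at time [m], [m] is divisible by a huge power of [2], so [x] carries at
    [n > 0] the same colour as [coloured]. As the valuations of [n] and [2 * n]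
    have opposite parities, [x] cannot show one and the same colour at both. *)
Lemma coloured_fiber (x : nat -> option bool) n :
  orbit_closure coloured x -> isSome \o x = sparse ->
  (0 < n)%N -> x n = x (2 * n)%N -> x n = None.
Proof.
move=> cx xE n_gt0.
have n_lt := ltn_expl_sq (2 * n).
have [m xm] := cx (2 ^ (2 * n) ^ 2)%N.
have m_dvd : (2 ^ (2 * n) ^ 2 %| m)%N.
  apply: sparse_return => j jN.
  by rewrite -coloured_isSome -xm// -[RHS](congr1 (fun f => f j) xE).
rewrite !xm//; last by lia.
rewrite /coloured; case: ifP => // _; case: ifP => // _ [].
rewrite !(logn_addl_small _ m_dvd)//; [|lia..].
by rewrite lognM// (_ : logn 2 2 = 1)%N// add1n /=; case: odd.
Qed.

Theorem proposition3p11 (R : realType) :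
  exists (X Y : metricType R) (T : X -> X) (S : Y -> Y) (pi : X -> Y) (y : Y),
    [/\ dynamical_system T, dynamical_system S,
        factor_map T S pi & proximal_map T pi] /\
    multi_recurrent S y /\
    forall x : X, (pi @^-1` [set y]) x -> ~ multi_recurrent T x.
Proof.
pose K := orbit_closure coloured.
pose KS := @orbit_closure_shift _ coloured.
pose g : option bool -> bool := isSome.
pose x0 : seq_space R K := exist _ _ (orbit_closure_self coloured).
exists (seq_space R K), (seq_space R (letter_image g K)).
exists (shift (K := K) KS), (shift (letter_image_shift KS)).
exists (@letter_map R _ _ g K), (letter_map g x0).
split; [split|split].
- by split; [exists x0|exact: orbit_closure_compact|exact: shift_continuous].
- split; [by exists (letter_map g x0)| |exact: shift_continuous].
  exact/letter_image_compact/orbit_closure_compact.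
- split; [exact: letter_map_continuous|exact: letter_map_surj|].
  by move=> x; exact: eq_sig_hprop.
- move=> x1 x2 /(congr1 sval) /= x12; apply: proximal_pair_shift => N m.
  (* Two points of the same fibre share the gaps of their common image. *)
  have N_lt := ltn_expl_sq N.
  have [p x1p] := proj2_sig x1 (m + 4 * 2 ^ N ^ 2)%N.
  have [n n_range n_gap] := sparse_gap N (p + m).
  exists (n - p)%N => [|j jN]; first lia.
  have x1_none : sval x1 (n - p + j)%N = None.
    rewrite x1p; last lia.
    rewrite addnA subnKC; last lia.
    by rewrite /coloured ifN// n_gap; lia.
  have := congr1 (fun f => f (n - p + j)%N) x12.
  by rewrite /= x1_none /g; case: (sval x2 _).
(* Offsetting the index by [d] makes the free zone long enough for all [i <= d]. *)
- move=> d _; exists (fun k => 2 ^ ((k + d) ^ 2).+1)%N; split.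
  + by move=> k l; rewrite leEnat leq_exp2l// ltnS leq_exp2r// leq_add2r.
  + by move=> k; rewrite expn_gt0.
  + move=> i /andP[_ i_le]; apply/cvg_iter_shiftP => N.
    exists N => k Nk j jN; rewrite /= /g !coloured_isSome.
    rewrite sparse_add//.
      apply: leq_ltn_trans (_ : i <= 2 * (k + d))%N (ltn_expl _ (ltnSn 1)).
      by lia.
    apply: (@leq_trans (k + d).+1); first by lia.
    by apply: leq_trans (ltn_expl_sq _) _; rewrite leq_exp2l.
- move=> x xy /(_ 2%N isT)[n [_ n_gt0 n_ret]].
  have /cvg_iter_shiftP/(_ 1%N)[k1 ret1] := n_ret 1%N isT.
  have /cvg_iter_shiftP/(_ 1%N)[k2 ret2] := n_ret 2%N isT.
  (* Recurrence along [n k] and [2 * n k] repeats the letter at the origin. *)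
  pose k := maxn k1 k2.
  have := ret1 k (leq_maxl _ _) 0%N isT; rewrite addn0 mul1n => x1.
  have := ret2 k (leq_maxr _ _) 0%N isT; rewrite addn0 => x2.
  have xE : isSome \o sval x = sparse.
    have /= -> := congr1 sval xy; apply/funext => j; exact: coloured_isSome.
  have := @coloured_fiber (sval x) (n k) (proj2_sig x) xE (n_gt0 k).
  rewrite -x1 -x2 => /(_ erefl) x0_none.
  have := congr1 (fun f => f 0%N) xE.
  by rewrite /= x0_none sparse0.
Qed.
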